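(* Let $P$ be a graphic positroid of rank $r$. Then there exist a graph $G$ and a real matrix $A$ such that $M(G)=M(A)=P$, $A$ has all nonnegative maximal minors, and $A$ is obtained from a signed incidence matrix of $G$ by deleting $|G|-r$ rows, where $|G|$ is the number of vertices of $G$.
   Context: An ordered matroid is a finite matroid whose ground set is totally ordered. A positroid is an ordered matroid on $E=\{e_1<\dots<e_n\}$, of rank $r$ say, for which there is a real $r\times n$ matrix of rank $r$, whose $j$-th column corresponds to $e_j$, which realizes the matroid and all of whose maximal minors are nonnegative. $M(A)$ is the ordered matroid of linear dependence among the columns of the matrix $A$ (the $j$-th column corresponding to $e_j$). Graphs may have loops and multiple edges and have totally ordered edge sets; $M(G)$ is the cycle matroid of $G$, on the ordered edge set of $G$, whose bases are the maximal forests of $G$. A matroid is graphic if it is isomorphic to $M(G)$ for some graph $G$. A signed incidence matrix of $G$ is a matrix with rows indexed by the vertices and columns indexed by the edges (in their order), obtained from some orientation of the edges: the column of a non-loop edge has one entry $1$ and one entry $-1$, in the rows of its two endpoints, and zeros elsewhere; the column of a loop is zero. The maximal minors of a matrix are the determinants of its maximal square submatrices. *)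

(* Defs.v *)
From mathcomp Require Import all_boot all_order all_algebra.
From mathcomp Require Import boolp reals.

Set Implicit Arguments.
Unset Strict Implicit.
Unset Printing Implicit Defensive.

Import GRing.Theory.
Local Open Scope ring_scope.

Record matroid (E : finType) := Matroid {
  indep : {set {set E}};
  indep_set0 : set0 \in indep;
  indep_subset : forall I J : {set E},
    I \subset J -> J \in indep -> I \in indep;
  indep_augment : forall I J : {set E},
    I \in indep -> J \in indep -> (#|I| < #|J|)%N ->
    exists2 x, x \in J :\: I & x |: I \in indep }.

Lemma matroid_inj (E : finType) : injective (@indep E).
Proof.
case=> [I1 a1 b1 c1] [I2 a2 b2 c2] /= eqI.
move: a1 b1 c1 a2 b2 c2; rewrite eqI => a1 b1 c1 a2 b2 c2.
by rewrite (Prop_irrelevance a1 a2) (Prop_irrelevance b1 b2)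
           (Prop_irrelevance c1 c2).
Qed.

Definition bases (E : finType) (M : matroid E) : {set {set E}} :=
  [set B | maxset (fun I => I \in indep M) B].

Definition mrank (E : finType) (M : matroid E) : nat :=
  \max_(I in indep M) #|I|.

Definition matroid_iso (E F : finType) (M : matroid E) (N : matroid F) : Prop :=
  exists2 f : E -> F, bijective f &
    forall I : {set E}, (I \in indep M) = (f @: I \in indep N).

Section LinearIndependence.
Variables (K : fieldType) (V : vectType K) (E : finType) (w : E -> V).

Definition lin_indep : {set {set E}} :=
  [set I : {set E} | free [seq w e | e <- enum I]].

Lemma lin_indepU1 (e : E) (I : {set E}) : e \notin I ->
  (e |: I \in lin_indep) =
  (w e \notin <<[seq w e | e <- enum I]>>%VS) && (I \in lin_indep).
Proof.
move=> eI; rewrite !inE -free_cons.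
have /(perm_map w)/perm_free -> // : perm_eq (enum (e |: I)) (e :: enum I).
apply: uniq_perm; rewrite ?enum_uniq //= ?mem_enum ?eI ?enum_uniq //.
by move=> x; rewrite mem_enum !inE mem_enum.
Qed.

Lemma lin_indepD1 (e : E) (I : {set E}) : e \in I ->
  (I \in lin_indep) = (w e \notin <<[seq w e | e <- enum (I :\ e)]>>%VS) &&
                      (I :\ e \in lin_indep).
Proof. by move=> eI; rewrite -{1}(setD1K eI) lin_indepU1 // !inE eqxx. Qed.

Lemma lin_indep_set0 : set0 \in lin_indep.
Proof. by rewrite inE enum_set0 nil_free. Qed.

Lemma lin_indep_subset (I J : {set E}) :
  I \subset J -> J \in lin_indep -> I \in lin_indep.
Proof.
move=> sIJ; rewrite !inE => fJ.
have pJ : perm_eq (enum J) (enum (J :\: I) ++ enum I).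
  apply: uniq_perm; rewrite ?cat_uniq ?enum_uniq ?andbT //=.
    by apply/hasPn => x; rewrite !mem_enum !inE => ->.
  move=> x; rewrite mem_cat !mem_enum !inE.
  by have [xI|] := boolP (x \in I); rewrite ?(subsetP sIJ _ xI) ?orbF.
move: fJ; rewrite (perm_free (perm_map w pJ)) map_cat.
exact: catr_free.
Qed.

Lemma lin_indep_augment (I J : {set E}) :
  I \in lin_indep -> J \in lin_indep -> (#|I| < #|J|)%N ->
  exists2 x, x \in J :\: I & x |: I \in lin_indep.
Proof.
move=> Ii Ji ltIJ.
have [/exists_inP[x xJI xI]|] :=
  boolP [exists x in J :\: I, x |: I \in lin_indep]; first by exists x.
rewrite negb_exists_in => /forall_inP noaug.
have sub : (<<[seq w e | e <- enum J]>> <= <<[seq w e | e <- enum I]>>)%VS.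
  apply/span_subvP => _ /mapP[x + ->]; rewrite mem_enum => xJ.
  have [xI|xI] := boolP (x \in I); first by rewrite memv_span ?map_f ?mem_enum.
  have := noaug x; rewrite inE xI xJ => /(_ isT).
  by rewrite lin_indepU1 // Ii andbT negbK.
move: (dimvS sub) Ii Ji; rewrite !inE /free => le /eqP eI /eqP eJ.
by move: le; rewrite eI eJ !size_map -!cardE leqNgt ltIJ.
Qed.

Definition linear_matroid : matroid E :=
  Matroid lin_indep_set0 lin_indep_subset lin_indep_augment.

End LinearIndependence.

Definition column_matroid (K : fieldType) (m n : nat) (A : 'M[K]_(m, n)) :
    matroid 'I_n :=
  linear_matroid (fun j => col j A).

(* An edge [e] is a loop when [ends e] is a singleton. *)
Record multigraph (E : finType) := Multigraph {
  nverts : nat;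
  ends : E -> {set 'I_nverts};
  ends_card : forall e, (0 < #|ends e| <= 2)%N }.

Section CycleMatroid.
Variables (E : finType) (G : multigraph E).
Local Notation V := 'I_(nverts G).

(* Distinct vertices [v_0, ..., v_(k-1)] and distinct edges [e_i] joining [v_i]
   to [v_(i+1 mod k)]; a loop is a cycle with [k = 1], and two parallel edges
   form a cycle with [k = 2]. *)
Definition is_cycle k (vs : {ffun 'I_k -> V}) (es : {ffun 'I_k -> E}) : bool :=
  [&& (0 < k)%N, injectiveb vs, injectiveb es &
      [forall i, ends G (es i) == [set vs i; vs (ordS i)]]].

(* The bound on [k] loses nothing, since [es] is injective. *)
Definition has_cycle (F : {set E}) : bool :=
  [exists k : 'I_#|E|.+1, exists vs : {ffun 'I_k -> V},
   exists es : {ffun 'I_k -> E},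
     is_cycle vs es && [forall i, es i \in F]].

Definition forests : {set {set E}} := [set F | ~~ has_cycle F].

Definition orientation (o : E -> V * V) : Prop :=
  forall e, ends G e = [set (o e).1; (o e).2].

End CycleMatroid.

(* [(o e).1] is the tail and [(o e).2] the head of [e]; the two terms cancel
   when [e] is a loop. *)
Definition incidence_col (K : fieldType) (E : finType) (G : multigraph E)
    (o : E -> 'I_(nverts G) * 'I_(nverts G)) (e : E) : 'cV[K]_(nverts G) :=
  \col_v ((v == (o e).2)%:R - (v == (o e).1)%:R).

Section ForestsAreIndependent.
Variables (K : fieldType) (E : finType) (G : multigraph E).
Variable o : E -> 'I_(nverts G) * 'I_(nverts G).
Hypothesis oP : orientation o.
Local Notation V := 'I_(nverts G).
Local Notation w := (incidence_col K o).

Lemma ends_eq2 (e : E) (u v : V) : ends G e = [set u; v] ->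
  ((o e).1 = u /\ (o e).2 = v) \/ ((o e).1 = v /\ (o e).2 = u).
Proof.
rewrite oP => eq2.
have : (o e).1 \in [set u; v] by rewrite -eq2 set21.
have : (o e).2 \in [set u; v] by rewrite -eq2 set22.
have : v \in [set (o e).1; (o e).2] by rewrite eq2 set22.
have : u \in [set (o e).1; (o e).2] by rewrite eq2 set21.
rewrite !inE; do 4![case/orP=> /eqP ?]; intuition congruence.
Qed.

Let diff (u v : V) : 'cV[K]_(nverts G) := \col_x ((x == v)%:R - (x == u)%:R).

Let w_diff (e : E) (u v : V) : ends G e = [set u; v] ->
  w e = diff u v \/ w e = - diff u v.
Proof.
move=> /ends_eq2[] [eu ev]; [left|right]; apply/matrixP => x y;
by rewrite !mxE eu ev ?opprB.
Qed.

Lemma has_cycle_dep (F : {set E}) : has_cycle G F -> F \notin lin_indep w.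
Proof.
case/existsP=> k /existsP[vs /existsP[es /andP[/and4P[k0 _ inje /forallP endP]
  /forallP inF]]].
have d0 : \sum_i diff (vs i) (vs (ordS i)) = 0.
  apply/matrixP => x y; rewrite !mxE summxE.
  under eq_bigr do rewrite mxE.
  rewrite sumrB; apply/eqP; rewrite subr_eq0; apply/eqP.
  rewrite [RHS](reindex (@ordS k)) //=.
  exact: onW_bij (ordS_bij k).
pose i0 := Ordinal k0.
rewrite (lin_indepD1 _ (inF i0)) negb_and negbK; apply/orP; left.
move: d0; rewrite (bigD1 i0) //= => /eqP; rewrite addr_eq0 => /eqP d0.
have dS : diff (vs i0) (vs (ordS i0)) \in
    <<[seq w e | e <- enum (F :\ es i0)]>>%VS.
  rewrite d0 memvN memv_suml // => i ne.
  have wS : w (es i) \in <<[seq w e | e <- enum (F :\ es i0)]>>%VS.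
    rewrite memv_span // map_f // mem_enum !inE inF andbT.
    by rewrite (inj_eq (injectiveP _ inje)).
  by have [<-|e] := w_diff (eqP (endP i)); rewrite // -memvN -e.
by have [->|->] := w_diff (eqP (endP i0)); rewrite // memvN.
Qed.

Let adj (F : {set E}) : rel V :=
  fun u v => [exists e in F, ends G e == [set u; v]].

Let connect_cycle (F : {set E}) (e : E) : e \in F ->
  connect (adj (F :\ e)) (o e).1 (o e).2 -> has_cycle G F.
Proof.
move=> eF /connectP[p0 /shortenP[p pp up _] lastp]; move: p pp up lastp => p.
set u := (o e).1 => pp up lastp.
pose k := (size p).+1.
have nthp i : (i < size p)%N -> adj (F :\ e) (nth u (u :: p) i) (nth u p i).
  by move=> ip; move/(pathP u): pp; apply.
pose ed i := odflt e [pick f in F :\ e |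
  ends G f == [set nth u (u :: p) i; nth u p i]].
have edP i : (i < size p)%N -> ed i \in F :\ e /\
    ends G (ed i) = [set nth u (u :: p) i; nth u p i].
  move=> /nthp /exists_inP[f fF fe]; rewrite /ed; case: pickP => [g|].
    by case/andP=> ? /eqP.
  by move/(_ f); rewrite fF fe.
pose vs := [ffun i : 'I_k => nth u (u :: p) i].
pose es := [ffun i : 'I_k => if (i < size p)%N then ed i else e].
have injv : injective vs.
  move=> i j; rewrite !ffunE => /eqP; rewrite nth_uniq ?ltn_ord //.
  by move/eqP/val_inj.
have endsE (i : 'I_k) : ends G (es i) = [set vs i; vs (ordS i)].
  rewrite !ffunE; case: ltnP => ip.
    have [_ ->] := edP i ip; congr [set _; _].
    by rewrite /= modn_small.
  have ei : i = size p :> nat.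
    by apply/eqP; rewrite eqn_leq ip -ltnS ltn_ord.
  rewrite [_ (ordS i)]/= ei modnn oP setUC -/u lastp.
  by rewrite -[last u p]/(last u (u :: p)) -nth_last.
have inje : injective es.
  move=> i j; rewrite !ffunE; case: ltnP => ip; case: ltnP => jp.
  - have [_ ei] := edP i ip; have [_ ej] := edP j jp.
    move=> eij; move: ei; rewrite eij ej => eqs.
    have U a b : (a <= size p)%N -> (b <= size p)%N ->
        (nth u (u :: p) a == nth u (u :: p) b) = (a == b).
      by move=> ? ?; rewrite nth_uniq.
    have := set21 (nth u (u :: p) i) (nth u (u :: p) i.+1).
    have := set22 (nth u (u :: p) i) (nth u (u :: p) i.+1).
    rewrite -[nth u (u :: p) i.+1]/(nth u p i) -eqs !inE.
    rewrite -[nth u p i]/(nth u (u :: p) i.+1).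
    rewrite -[nth u p j]/(nth u (u :: p) j.+1).
    rewrite !U ?(ltnW ip) ?(ltnW jp) //.
    move=> h1 h2; apply/val_inj/eqP => /=.
    case/orP: h2 => // /eqP h2; move: h1; rewrite h2 eqSS.
    by rewrite (gtn_eqF (leqW (ltnSn j))) (gtn_eqF (ltnSn j)).
  - by have [+ _] := edP i ip; rewrite in_setD1 => /andP[/eqP ne _] /ne.
  - by have [+ _] := edP j jp; rewrite in_setD1 => /andP[/eqP ne _] /esym/ne.
  - move=> _; apply/val_inj => /=; transitivity (size p).
      by apply/eqP; rewrite eqn_leq ip -ltnS ltn_ord.
    by apply/eqP; rewrite eqn_leq jp -ltnS ltn_ord.
have kE : (k < #|E|.+1)%N by have := leq_card es inje; rewrite card_ord ltnS.
apply/existsP; exists (Ordinal kE); apply/existsP; exists vs.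
apply/existsP; exists es; apply/andP; split.
  apply/and4P; split=> //; try exact/injectiveP.
  by apply/forallP => i; rewrite endsE.
apply/forallP => i; rewrite ffunE; case: ltnP => // ip.
by have [] := edP i ip; rewrite inE => /andP[].
Qed.

Lemma dep_has_cycle (F : {set E}) : F \notin lin_indep w -> has_cycle G F.
Proof.
have mono (A B : {set E}) : A \subset B -> has_cycle G A -> has_cycle G B.
  move=> AB /existsP[k /existsP[vs /existsP[es /andP[c /forallP h]]]].
  apply/existsP; exists k; apply/existsP; exists vs; apply/existsP; exists es.
  by rewrite c; apply/forallP => i; apply: (subsetP AB).
have [n] := ubnP #|F|; elim: n F => // n IHn F ltF.
have [->|[e eF]] := set_0Vmem F; first by rewrite lin_indep_set0.
rewrite (lin_indepD1 _ eF) negb_and negbK => /orP[wS|]; last first.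
  move=> /IHn h; apply: mono (h _); first exact: subsetDl.
  by move: ltF; rewrite (cardsD1 e) eF.
apply: (connect_cycle eF); apply: contraT => nc.
set F' := F :\ e in wS nc *.
have sc : connect_sym (adj F').
  by apply: sym_connect_sym => x y; rewrite /adj; under eq_existsb do rewrite setUC.
pose c : 'rV[K]_(nverts G) := \row_v (connect (adj F') (o e).1 v)%:R.
have cdiff f : c *m w f = (connect (adj F') (o e).1 (o f).2)%:R%:M
                        - (connect (adj F') (o e).1 (o f).1)%:R%:M.
  apply/matrixP => i j; rewrite !ord1 !mxE eqxx !mulr1n.
  under eq_bigr do rewrite !mxE mulrBr.
  rewrite sumrB; congr (_ - _).
    rewrite (bigD1 (o f).2) //= eqxx mulr1 big1 ?addr0 // => v /negbTE ->.
    by rewrite mulr0.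
  rewrite (bigD1 (o f).1) //= eqxx mulr1 big1 ?addr0 // => v /negbTE ->.
  by rewrite mulr0.
have cw : c *m w e = 0.
  have /coord_span -> : w e \in <<in_tuple [seq w e | e <- enum F']>>%VS by [].
  rewrite mulmx_sumr big1 // => i _; rewrite -scalemxAr.
  have /mapP[f fF ->] : (in_tuple [seq w e | e <- enum F'])`_i
    \in [seq w e | e <- enum F'] by rewrite mem_nth.
  rewrite cdiff; suff -> : connect (adj F') (o e).1 (o f).2 =
    connect (adj F') (o e).1 (o f).1 by rewrite subrr scaler0.
  rewrite mem_enum in fF.
  apply/esym/(same_connect_r sc)/connect1/exists_inP.
  by exists f; rewrite // oP.
have := cdiff e; rewrite cw (negbTE nc) connect0 => /matrixP/(_ 0 0).
by rewrite !mxE eqxx !mulr1n sub0r => /eqP; rewrite eq_sym oppr_eq0 oner_eq0.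
Qed.

Lemma forests_lin_indep : forests G = lin_indep w.
Proof.
apply/setP => F; rewrite [LHS]inE.
apply/idP/idP; first by apply: contraNT; apply: dep_has_cycle.
by apply: contraTN; apply: has_cycle_dep.
Qed.

End ForestsAreIndependent.

Lemma orientation_ex (E : finType) (G : multigraph E) :
  exists o : E -> 'I_(nverts G) * 'I_(nverts G), orientation o.
Proof.
suff h (e : E) : exists p, ends G e = [set p.1; p.2].
  have [o oP] := fin_all_exists h; by exists o.
have /andP[pos le2] := ends_card G e.
have [eq2|ne2] := eqVneq #|ends G e| 2.
  by have /eqP/cards2P[x [y [_ ->]]] := eq2; exists (x, y).
have /cards1P[x ->] : #|ends G e| == 1 by move: #|_| pos le2 ne2 => [|[|[]]].
by exists (x, x); rewrite setUid.
Qed.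

Section CycleMatroidDef.
Variables (E : finType) (G : multigraph E).

Lemma forest_set0 : set0 \in forests G.
Proof.
have [o oP] := orientation_ex G.
by rewrite (forests_lin_indep rat oP) lin_indep_set0.
Qed.

Lemma forest_subset (I J : {set E}) :
  I \subset J -> J \in forests G -> I \in forests G.
Proof.
have [o oP] := orientation_ex G.
by rewrite (forests_lin_indep rat oP); apply: lin_indep_subset.
Qed.

Lemma forest_augment (I J : {set E}) :
  I \in forests G -> J \in forests G -> (#|I| < #|J|)%N ->
  exists2 x, x \in J :\: I & x |: I \in forests G.
Proof.
have [o oP] := orientation_ex G.
by rewrite (forests_lin_indep rat oP); apply: lin_indep_augment.
Qed.

Definition cycle_matroid : matroid E :=
  Matroid forest_set0 forest_subset forest_augment.

Lemma bases_cycle_matroid (B : {set E}) :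
  (B \in bases cycle_matroid) = maxset (fun F => F \in forests G) B.
Proof. by rewrite inE. Qed.

End CycleMatroidDef.

Definition graphic (E : finType) (M : matroid E) : Prop :=
  exists (F : finType) (G : multigraph F), matroid_iso M (cycle_matroid G).

Definition incidence_mx (K : fieldType) (n : nat) (G : multigraph 'I_n)
    (o : 'I_n -> 'I_(nverts G) * 'I_(nverts G)) : 'M[K]_(nverts G, n) :=
  \matrix_(v, j) incidence_col K o j v 0.

Definition signed_incidence (K : fieldType) (n : nat) (G : multigraph 'I_n)
    (D : 'M[K]_(nverts G, n)) : Prop :=
  exists2 o, orientation o & D = incidence_mx K o.

(* The rows kept are those in the image of [f], in their original order. *)
Definition deletes_rows (K : fieldType) (m r n : nat)
    (D : 'M[K]_(m, n)) (A : 'M[K]_(r, n)) : Prop :=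
  exists2 f : 'I_r -> 'I_m,
    {homo f : i j / (i < j)%N} & A = rowsub f D.

(* The submatrices are of size [minn r n]; when [r <= n] all rows are used. *)
Definition nonneg_maximal_minors (R : realType) (r n : nat)
    (A : 'M[R]_(r, n)) : Prop :=
  forall (f : 'I_(minn r n) -> 'I_r) (g : 'I_(minn r n) -> 'I_n),
    {homo f : i j / (i < j)%N} -> {homo g : i j / (i < j)%N} ->
    0 <= \det (mxsub f g A).

(* A matroid on ['I_n] is an ordered matroid, ['I_n] carrying its usual order. *)
Definition positroid (R : realType) (n : nat) (P : matroid 'I_n) : Prop :=
  exists A : 'M[R]_(mrank P, n),
    [/\ \rank A = mrank P, column_matroid A = P & nonneg_maximal_minors A].

(* Main.v *)
Require Import Defs.
From mathcomp Require Import all_boot all_order all_algebra.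
From mathcomp Require Import reals.
From mathcomp Require Import perm boolp zify ring.

(** The theorem holds because a graphic matroid is binary, and a binary matroid
    has at most one representation over a given field, up to row operations and
    column scaling ([binary_matrix_unique]).

    Take a real representation A of P with nonnegative maximal minors, a graph G
    with M(G) = P, and a set of rows of a signed incidence matrix of G that is a row
    basis; call D the matrix of these rows.  Both A and D represent P, and so
    does a signed incidence matrix over F_2, which makes P binary.  By
    uniqueness, A = T D diag(s) with T invertible and every s_j nonzero.
    Reversing the edges j with s_j < 0 replaces s_j by |s_j|, and keeps D a
    submatrix of a signed incidence matrix.  Each maximal minor of A is then
    det T times a positive number times the same minor of D, so that D has
    nonnegative maximal minors as soon as det T > 0.  The sign of det T can be
    changed by exchanging the names of two vertices whose rows are kept, or by
    reversing all the edges when the rank is 1 ([positive_equivalence]).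

    Uniqueness is proved for matrices whose columns at a fixed basis form the
    identity.  Their nonzero entries are in the same places, because an entry
    is the minor obtained by one exchange in the basis
    ([exchange_minor]).  It remains to find rho and sigma with
    A_ij = rho_i D_ij sigma_j, and the columns are added one at a time.  A new
    column v prescribes the factor A_iv / (rho_i D_iv) by which rho_i has to be
    corrected, and a correction is harmless for the earlier columns if it is
    constant on the classes of rows that they connect.  So two rows x and y in
    the support of v that are connected by earlier columns must prescribe the
    same factor ([scale_along_path]).  Along a shortest path from x to y, these
    columns and v form a submatrix with the support of a cycle, whose
    determinant has only two terms ([ring_minor]).  Over F_2 both are 1, so the
    minor vanishes; then it vanishes for A and for D too, and the two equations
    obtained say that the factors at x and at y agree. *)

Set Implicit Arguments.
Unset Strict Implicit.
Unset Printing Implicit Defensive.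

Import Order.TTheory GRing.Theory Num.Theory.
Local Open Scope ring_scope.

(** * Minors of a matrix in normal form with respect to a basis *)

Lemma det_eq0P (K : fieldType) (r : nat) (N : 'M[K]_r) :
  reflect (exists2 y : 'I_r -> K, exists i, y i != 0 &
             forall l, \sum_i y i * N i l = 0)
          (\det N == 0).
Proof.
apply: (iffP det0P) => [[v vN0 vN]|[y [i yi] yN]].
  exists (v 0); first by apply/rV0Pn.
  by move=> l; move/rowP/(_ l): vN; rewrite !mxE.
exists (\row_i y i); first by apply/rV0Pn; exists i; rewrite mxE.
by apply/rowP => l; rewrite !mxE -[RHS](yN l); apply: eq_bigr => j _; rewrite mxE.
Qed.

Lemma sum_two (K : nmodType) (I : finType) (F : I -> K) (u v : I) :
  u != v -> (forall i, i != u -> i != v -> F i = 0) -> \sum_i F i = F u + F v.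
Proof.
move=> uv F0; rewrite (bigD1 u) //= (bigD1 v) 1?eq_sym //= big1 ?addr0 //.
by move=> i /andP[]; apply: F0.
Qed.

Section NormalForm.
Variables (K : fieldType) (r n : nat) (M : 'M[K]_(r, n)) (b : 'I_r -> 'I_n).
Hypothesis Mb : colsub b M = 1%:M.

Lemma normal_entry i l : M i (b l) = (i == l)%:R.
Proof. by move/matrixP/(_ i l): Mb; rewrite !mxE. Qed.

Lemma sum_normal (y : 'I_r -> K) l : \sum_i y i * M i (b l) = y l.
Proof.
rewrite (bigD1 l) //= normal_entry eqxx mulr1 big1 ?addr0 // => i /negbTE il.
by rewrite normal_entry il mulr0.
Qed.

(** A vector that kills the columns of the exchanged basis vanishes outside i,
    since it kills the remaining basis columns. *)
Lemma exchange_minor i j :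
  (\det (colsub (fun l => if l == i then j else b l) M) == 0) = (M i j == 0).
Proof.
apply/det_eq0P/eqP => [[y [i0 yi0] yM]|Mij].
  have y0 l : l != i -> y l = 0.
    move=> /negbTE li; rewrite -(sum_normal y) -[RHS](yM l).
    by apply: eq_bigr => s _; rewrite !mxE li.
  have yi : y i != 0.
    by apply: contraNneq yi0 => yi; case: (eqVneq i0 i) => [->|/y0->//]; apply/eqP.
  move: (yM i); rewrite (bigD1 i) //= big1 ?addr0 => [|l li].
    by rewrite !mxE eqxx => /eqP; rewrite mulf_eq0 (negbTE yi) => /eqP.
  by rewrite y0 ?mul0r.
exists (fun l => (l == i)%:R); first by exists i; rewrite eqxx oner_eq0.
move=> l; rewrite (bigD1 i) //= eqxx mul1r big1 ?addr0 => [|s /negbTE->]; last first.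
  by rewrite mul0r.
by rewrite !mxE; case: eqVneq => // li; rewrite normal_entry eq_sym (negbTE li).
Qed.

(** The rows z_0, ..., z_k and the columns c_0, ..., c_k form a cycle: c_t joins
    z_t to z_(t+1) for t < k, and c_k joins z_k to z_0. *)
Section Ring.
Variables (k : nat) (z : nat -> 'I_r) (c : nat -> 'I_n).
Hypothesis k_gt0 : (0 < k)%N.
Hypothesis z_inj : forall s t, (s <= k)%N -> (t <= k)%N -> z s = z t -> s = t.
Hypothesis supp_path : forall s t, (s <= k)%N -> (t < k)%N ->
  (M (z s) (c t) != 0) = (s == t) || (s == t.+1).
Hypothesis supp_last : forall s, (s <= k)%N ->
  (M (z s) (c k) != 0) = (s == 0%N) || (s == k).

Definition ring_index (i : 'I_r) := index i [seq z t | t <- iota 0 k.+1].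

(** The columns of the cycle, completed by the basis columns of the rows that
    are off the cycle; indexing them by rows gives a square submatrix. *)
Definition ring_cols (i : 'I_r) : 'I_n :=
  if (ring_index i <= k)%N then c (ring_index i) else b i.

(** The ratio y_(z_t) / y_(z_0) forced on a vector y supported on the cycle that
    kills the columns c_s with s < t. *)
Definition transport t : K :=
  \prod_(s < t) - (M (z s) (c s) / M (z s.+1) (c s)).

Let nth_z t : (t <= k)%N -> nth (z 0%N) [seq z t | t <- iota 0 k.+1] t = z t.
Proof. by move=> tk; rewrite (nth_map 0%N) ?size_iota // nth_iota. Qed.

Lemma ring_indexK t : (t <= k)%N -> ring_index (z t) = t.
Proof.
move=> tk; rewrite /ring_index -{1}(nth_z tk) index_uniq ?size_map ?size_iota //.
rewrite map_inj_in_uniq ?iota_uniq // => s u; rewrite !mem_iota /= !add0n !ltnS.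
exact: z_inj.
Qed.

Lemma ring_indexE i : (ring_index i <= k)%N -> z (ring_index i) = i.
Proof.
by move=> ik; rewrite -nth_z // nth_index // -index_mem size_map size_iota.
Qed.

Lemma ring_sum (y : 'I_r -> K) t :
  (forall i, (k < ring_index i)%N -> y i = 0) -> (t < k)%N ->
  \sum_i y i * M i (c t) = y (z t) * M (z t) (c t) + y (z t.+1) * M (z t.+1) (c t).
Proof.
move=> y0 tk; apply: sum_two.
  by apply/eqP => /z_inj e; have := e (ltnW tk) tk => /eqP; rewrite ltn_eqF.
move=> i it it1; have [ik|/y0->] := leqP (ring_index i) k; last by rewrite mul0r.
have /negbFE/eqP-> : (M i (c t) != 0) = false; last by rewrite mulr0.
rewrite -{1}(ring_indexE ik) supp_path //; apply/norP.
by split; [apply: contraNneq it|apply: contraNneq it1] => <-; rewrite ring_indexE.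
Qed.

Lemma ring_sum_last (y : 'I_r -> K) :
  (forall i, (k < ring_index i)%N -> y i = 0) ->
  \sum_i y i * M i (c k) = y (z 0%N) * M (z 0%N) (c k) + y (z k) * M (z k) (c k).
Proof.
move=> y0; apply: sum_two.
  by apply/eqP => /z_inj e; have := e isT (leqnn _) => /eqP; rewrite ltn_eqF.
move=> i it it1; have [ik|/y0->] := leqP (ring_index i) k; last by rewrite mul0r.
have /negbFE/eqP-> : (M i (c k) != 0) = false; last by rewrite mulr0.
rewrite -{1}(ring_indexE ik) supp_last //; apply/norP.
by split; [apply: contraNneq it|apply: contraNneq it1] => <-; rewrite ring_indexE.
Qed.

(** A vector killing the columns [ring_cols] vanishes off the cycle, because of
    the basis columns; on the path it is determined by its value at z_0, by
    transport; and the last column c_k closes the cycle. *)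
Lemma ring_minor : (\det (colsub ring_cols M) == 0) =
  (M (z 0%N) (c k) + transport k * M (z k) (c k) == 0).
Proof.
have nz t : (t < k)%N -> M (z t) (c t) != 0.
  by move=> tk; rewrite supp_path ?eqxx // ltnW.
have nz1 t : (t < k)%N -> M (z t.+1) (c t) != 0.
  by move=> tk; rewrite supp_path ?eqxx ?orbT.
have trS t : transport t.+1 = - (transport t * (M (z t) (c t) / M (z t.+1) (c t))).
  by rewrite /transport big_ord_recr /= mulrN.
apply/det_eq0P/eqP => [[y [i0 yi0] yM]|h].
  have yoff i : (k < ring_index i)%N -> y i = 0.
    move=> ki; rewrite -(sum_normal y) -[RHS](yM i).
    by apply: eq_bigr => s _; rewrite !mxE /ring_cols leqNgt ki.
  have yc t : (t <= k)%N -> \sum_i y i * M i (c t) = 0.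
    move=> tk; rewrite -[RHS](yM (z t)); apply: eq_bigr => s _.
    by rewrite !mxE /ring_cols ring_indexK // tk.
  have yz t : (t <= k)%N -> y (z t) = y (z 0%N) * transport t.
    elim: t => [|t IHt] tk; first by rewrite /transport big_ord0 mulr1.
    have := yc t (ltnW tk); rewrite ring_sum // IHt ?(ltnW tk) // => /eqP.
    rewrite addrC addr_eq0 => /eqP e; apply: (mulIf (nz1 _ tk)).
    by rewrite e trS mulrN mulNr !mulrA divfK ?nz1.
  have y0 : y (z 0%N) != 0.
    apply: contraNneq yi0 => y0; have [ik|/yoff->//] := leqP (ring_index i0) k.
    by rewrite -(ring_indexE ik) yz // y0 mul0r.
  have := yc k (leqnn k); rewrite ring_sum_last // (yz k) // -mulrA -mulrDr.
  by move/eqP; rewrite mulf_eq0 (negbTE y0) => /eqP.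
pose y i := if (ring_index i <= k)%N then transport (ring_index i) else 0.
have yoff i : (k < ring_index i)%N -> y i = 0 by rewrite ltnNge /y => /negbTE->.
have yz t : (t <= k)%N -> y (z t) = transport t.
  by move=> tk; rewrite /y ring_indexK // tk.
exists y; first by exists (z 0%N); rewrite yz // /transport big_ord0 oner_eq0.
move=> l; under eq_bigr do rewrite !mxE; rewrite /ring_cols; case: leqP => lk.
  move: lk; rewrite leq_eqVlt => /orP[/eqP->|lk].
    by rewrite ring_sum_last // !yz // {1}/transport big_ord0 mul1r.
  rewrite ring_sum // (yz _ lk) (yz _ (ltnW lk)) trS.
  by rewrite mulNr -mulrA divfK ?nz1 // subrr.
by rewrite sum_normal yoff.
Qed.
End Ring.
End NormalForm.

(** * Uniqueness of the representations of a binary matroid *)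

Section DiagonalEquivalence.
Variables (K : fieldType) (r n : nat) (A D : 'M[K]_(r, n)).
Variables (X : 'M['F_2]_(r, n)) (b : 'I_r -> 'I_n).
Hypotheses (Ab : colsub b A = 1%:M) (Db : colsub b D = 1%:M).
Hypothesis Xb : colsub b X = 1%:M.
Hypothesis detA : forall g, (\det (colsub g A) == 0) = (\det (colsub g X) == 0).
Hypothesis detD : forall g, (\det (colsub g D) == 0) = (\det (colsub g X) == 0).

Lemma suppAX i j : (A i j == 0) = (X i j == 0).
Proof. by rewrite -(exchange_minor Ab) detA (exchange_minor Xb). Qed.

Lemma suppDX i j : (D i j == 0) = (X i j == 0).
Proof. by rewrite -(exchange_minor Db) detD (exchange_minor Xb). Qed.

Lemma suppAD i j : (A i j == 0) = (D i j == 0).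
Proof. by rewrite suppAX suppDX. Qed.

Definition row_adj (S : {pred 'I_n}) : rel 'I_r :=
  fun i i' => [exists j in S, (D i j != 0) && (D i' j != 0)].

Lemma F2_neq0 (x : 'F_2) : x != 0 -> x = 1.
Proof. by case: x => [[|[|]]] // ? _; apply: val_inj. Qed.

(** Strong induction on the length of the path: a chord of the path, or an
    interior row in the support of v, gives shorter paths; without them, the
    columns of the path and v form a cycle to which [ring_minor] applies. *)
Lemma scale_along_path (S : {pred 'I_n}) (v : 'I_n)
    (rho : 'I_r -> K) (sigma : 'I_n -> K) :
  (forall i, rho i != 0) -> (forall j, sigma j != 0) ->
  (forall i j, j \in S -> A i j = rho i * D i j * sigma j) ->
  forall k (z : nat -> 'I_r), D (z 0%N) v != 0 -> D (z k) v != 0 ->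
  (forall t, (t < k)%N -> row_adj S (z t) (z t.+1)) ->
  A (z 0%N) v / (rho (z 0%N) * D (z 0%N) v) = A (z k) v / (rho (z k) * D (z k) v).
Proof.
move=> rho0 sigma0 AD k; elim/ltn_ind: k => k IHk z z0v zkv adj.
case: (posnP k) => [->//|k0].
(* A chord from z_a to z_d cuts out d - (a + 1) steps of the path. *)
have chord a d : (a.+1 < d)%N -> (d <= k)%N -> row_adj S (z a) (z d) ->
    A (z 0%N) v / (rho (z 0%N) * D (z 0%N) v) = A (z k) v / (rho (z k) * D (z k) v).
  move=> ad dk ead; pose w t := if (t <= a)%N then z t else z (t + (d - a.+1))%N.
  have wk : w (k - (d - a.+1))%N = z k.
    by rewrite /w leqNgt ifF; [congr z; lia|apply/negbTE; lia].
  have := IHk (k - (d - a.+1))%N _ w; rewrite wk; apply=> //; first lia.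
  move=> t tk; rewrite /w; case: (ltngtP t a) => [ta|ta|->].
  - by rewrite adj //; lia.
  - by rewrite addSn adj //; lia.
  - by rewrite (_ : a.+1 + (d - a.+1) = d)%N //; lia.
have [[a [d [ad dk ead]]]|nochord] := pselect (exists a d,
  [/\ (a.+1 < d)%N, (d <= k)%N & row_adj S (z a) (z d)]); first exact: chord ad dk ead.
have {chord}nochord a d : (a.+1 < d)%N -> (d <= k)%N -> row_adj S (z a) (z d) = false.
  by move=> ad dk; apply/negbTE/negP => e; case: nochord; exists a, d; split.
have [->//|zk0] := eqVneq (z 0%N) (z k).
(* A repetition z_s = z_t is a chord in disguise: from z_s to z_(t+1), or from
   z_(s-1) to z_t when t = k. *)
have zlt s t : (s < t)%N -> (t <= k)%N -> z s <> z t.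
  move=> st tk zst; move: tk; rewrite leq_eqVlt => /orP[/eqP tk|tk].
    case: s st zst => [|s] st zst; first by rewrite -tk -zst eqxx in zk0.
    by have := nochord s t st; rewrite tk leqnn -tk -zst adj => [/(_ isT)|]; last lia.
  by have := nochord s t.+1 st tk; rewrite zst adj.
have z_inj s t : (s <= k)%N -> (t <= k)%N -> z s = z t -> s = t.
  by move=> sk tk; case: (ltngtP s t) => // [/zlt h /h|/zlt h /esym/h] //; apply.
have [[s [sk s0 sv]]|noint] := pselect (exists s,
    [/\ (s < k)%N, (0 < s)%N & D (z s) v != 0]).
  transitivity (A (z s) v / (rho (z s) * D (z s) v)).
    by apply: IHk => // t ts; apply: adj; apply: ltn_trans ts sk.
  have := IHk (k - s)%N _ (fun t => z (t + s)%N); rewrite subnK ?(ltnW sk) //.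
  apply=> //; first by lia.
  by move=> t tk; rewrite addSn; apply: adj; lia.
pose c t := if t == k then v else
  odflt v [pick j in S | (D (z t) j != 0) && (D (z t.+1) j != 0)].
have ck : c k = v by rewrite /c eqxx.
have cP t : (t < k)%N -> [/\ c t \in S, D (z t) (c t) != 0 & D (z t.+1) (c t) != 0].
  move=> tk; rewrite /c (ltn_eqF tk); case: pickP => [j /and3P[]//|no].
  by have /exists_inP[j jS h] := adj t tk; move: (no j); rewrite /= jS h.
have suppD s t : (s <= k)%N -> (t < k)%N ->
    (D (z s) (c t) != 0) = (s == t) || (s == t.+1).
  move=> sk tk; have [tS ct ct1] := cP t tk.
  apply/idP/orP => [sc|[]/eqP->//].
  have [st|st|->] := ltngtP s t; last by left.
    suff: row_adj S (z s) (z t.+1) by rewrite nochord.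
    by apply/exists_inP; exists (c t); rewrite // sc.
  right; case: (ltngtP s t.+1) => // [|st1]; first by rewrite ltnS leqNgt st.
  suff: row_adj S (z t) (z s) by rewrite nochord.
  by apply/exists_inP; exists (c t); rewrite // ct.
have suppDk s : (s <= k)%N -> (D (z s) (c k) != 0) = (s == 0%N) || (s == k).
  move=> sk; rewrite ck; apply/idP/orP => [sv|[]/eqP->//].
  case: (posnP s) => [->|s0]; [by left|right].
  move: sk; rewrite leq_eqVlt => /orP[//|sk].
  by case: noint; exists s.
have minorE (F : fieldType) (M : 'M[F]_(r, n)) : colsub b M = 1%:M ->
    (forall i j, (M i j == 0) = (D i j == 0)) ->
    (\det (colsub (ring_cols b k z c) M) == 0) =
    (M (z 0%N) v + transport M z c k * M (z k) v == 0).
  move=> Mb MD; rewrite (ring_minor Mb k0 z_inj) ?ck // => *; rewrite MD.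
    exact: suppD.
  by rewrite -ck; apply: suppDk.
(* Over F_2 both terms of the minor are 1. *)
have detX : \det (colsub (ring_cols b k z c) X) == 0.
  rewrite minorE // => [|i j]; last by rewrite suppDX.
  have X1 i j : D i j != 0 -> X i j = 1 by rewrite suppDX => /F2_neq0.
  rewrite !X1 // mulr1.
  rewrite /transport big1 // => t _; have [_ ct ct1] := cP t (ltn_ord t).
  by rewrite !X1 //; apply: val_inj.
have := detX; rewrite -detA minorE // => [|i j]; last by rewrite suppAD.
rewrite addr_eq0 => /eqP eA.
have := detX; rewrite -detD minorE // addr_eq0 => /eqP eD.
have trAD t : (t <= k)%N ->
    transport A z c t = transport D z c t * rho (z 0%N) / rho (z t).
  elim: t => [|t IHt] tk.
    by rewrite /transport !big_ord0 mul1r divff.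
  have [tS ct ct1] := cP t tk.
  move: (IHt (ltnW tk)); rewrite /transport !big_ord_recr /= => ->.
  by rewrite !AD //; field; rewrite ct1 !rho0 sigma0.
have tr0 : transport D z c k != 0.
  by apply: contraNneq z0v => tr0; rewrite eD tr0 mul0r oppr0.
by rewrite eA eD trAD //; field; rewrite zkv oppr_eq0 mulf_neq0 ?rho0.
Qed.

(** Induction on the number of columns treated.  In the step, the factor
    prescribed by the new column at a row is extended to the whole connected
    component of this row, and divided out of the earlier columns. *)
Lemma diagonal_equivalence : exists (rho : 'I_r -> K) (sigma : 'I_n -> K),
  [/\ forall i, rho i != 0, forall j, sigma j != 0 &
      forall i j, A i j = rho i * D i j * sigma j].
Proof.
suff step m : exists (rho : 'I_r -> K) (sigma : 'I_n -> K),
  [/\ forall i, rho i != 0, forall j, sigma j != 0 &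
    forall i (j : 'I_n), (j < m)%N -> A i j = rho i * D i j * sigma j].
  have [rho [sigma [rho0 sigma0 AD]]] := step n.
  by exists rho, sigma; split=> // i j; apply: AD.
elim: m => [|m [rho [sigma [rho0 sigma0 AD]]]].
  by exists (fun=> 1), (fun=> 1); split=> // *; rewrite oner_eq0.
have [nm|mn] := leqP n m.
  by exists rho, sigma; split=> // i j _; apply/AD/(leq_trans (ltn_ord j)).
pose v := Ordinal mn; pose S : {pred 'I_n} := [pred j : 'I_n | (j < m)%N].
pose c i := A i v / (rho i * D i v).
have sc : connect_sym (row_adj S).
  apply: sym_connect_sym => x y; rewrite /row_adj.
  by apply: eq_existsb => j; congr (_ && _); apply: andbC.
have c_const x y : D x v != 0 -> D y v != 0 -> connect (row_adj S) x y -> c x = c y.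
  move=> xv yv /connectP[p pp yp].
  have := scale_along_path rho0 sigma0 AD (k := size p) (z := nth x (x :: p)).
  have -> : nth x (x :: p) (size p) = y by rewrite yp (last_nth x).
  by apply=> // t tp; move/(pathP x): pp; apply.
(* Components are named by their root; [lam a] is the correction on component a. *)
pose lam (a : 'I_r) : K :=
  if [pick x | (D x v != 0) && (fingraph.root (row_adj S) x == a)] is Some x
  then c x else 1.
have lam0 a : lam a != 0.
  rewrite /lam; case: pickP => [x /andP[xv _]|_]; last by rewrite oner_eq0.
  by rewrite !mulf_neq0 // ?invr_eq0 ?mulf_neq0 // suppAD.
have lamv x : D x v != 0 -> lam (fingraph.root (row_adj S) x) = c x.
  move=> xv; rewrite /lam; case: pickP => [y /andP[yv /eqP xy]|/(_ x)]; last first.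
    by rewrite xv eqxx.
  by apply: c_const => //; apply/(fingraph.rootP sc).
exists (fun i => rho i * lam (fingraph.root (row_adj S) i)).
exists (fun j => if j == v then 1 else
  if [pick i | D i j != 0] is Some i then sigma j / lam (fingraph.root (row_adj S) i)
  else sigma j).
split=> [i|j|i j].
- exact: mulf_neq0.
- case: (j =P v) => _; first by rewrite oner_eq0.
  by case: pickP => // i _; rewrite mulf_neq0 ?invr_eq0.
move=> jm; have [Dij|Dij] := eqVneq (D i j) 0.
  by apply/eqP; rewrite Dij mulr0 mul0r suppAD Dij.
case: (eqVneq j v) jm Dij => [->|jv] jm Dij.
  by rewrite lamv // /c; field; rewrite rho0 Dij.
have {}jm : (j < m)%N.
  by rewrite ltn_neqAle -ltnS jm andbT; apply: contra_neq jv => jm'; apply: val_inj.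
case: pickP => [l Dlj|/(_ i)]; last by rewrite Dij.
have -> : fingraph.root (row_adj S) l = fingraph.root (row_adj S) i.
  apply/(fingraph.rootP sc)/connect1/exists_inP; exists j => //.
  by rewrite Dlj.
by rewrite AD //; field.
Qed.

End DiagonalEquivalence.

(** Multiplication by the inverse of the basis columns reduces to the normal
    form and does not change which maximal minors vanish. *)
Lemma binary_matrix_unique (K : fieldType) (r n : nat) (A D : 'M[K]_(r, n))
    (X : 'M['F_2]_(r, n)) (b : 'I_r -> 'I_n) : \det (colsub b X) != 0 ->
  (forall g, (\det (colsub g A) == 0) = (\det (colsub g X) == 0)) ->
  (forall g, (\det (colsub g D) == 0) = (\det (colsub g X) == 0)) ->
  exists (T : 'M[K]_r) (s : 'I_n -> K),
  [/\ T \in unitmx, forall j, s j != 0 & forall i j, A i j = (T *m D) i j * s j].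
Proof.
have normal (F : fieldType) (M : 'M[F]_(r, n)) : \det (colsub b M) != 0 ->
    colsub b M \in unitmx /\ colsub b (invmx (colsub b M) *m M) = 1%:M.
  rewrite -unitfE -[_ \is a _]/(colsub b M \in unitmx) => Mu.
  by rewrite -mulmx_colsub mulVmx.
have detN (F : fieldType) (M : 'M[F]_(r, n)) g : colsub b M \in unitmx ->
    (\det (colsub g (invmx (colsub b M) *m M)) == 0) = (\det (colsub g M) == 0).
  move=> Mu; rewrite -mulmx_colsub det_mulmx det_inv mulf_eq0 invr_eq0.
  by rewrite unitmxE unitfE in Mu; rewrite (negbTE Mu).
move=> bX detA detD.
have [Xu Xb] := normal _ _ bX.
have bA : \det (colsub b A) != 0 by rewrite detA.
have bD : \det (colsub b D) != 0 by rewrite detD.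
have [[Au Ab] [Du Db]] := (normal _ _ bA, normal _ _ bD).
have minorA g : (\det (colsub g (invmx (colsub b A) *m A)) == 0) =
    (\det (colsub g (invmx (colsub b X) *m X)) == 0) by rewrite !detN.
have minorD g : (\det (colsub g (invmx (colsub b D) *m D)) == 0) =
    (\det (colsub g (invmx (colsub b X) *m X)) == 0) by rewrite !detN.
have [rho [sigma [rho0 sigma0 E]]] := diagonal_equivalence Ab Db Xb minorA minorD.
exists (colsub b A *m diag_mx (\row_i rho i) *m invmx (colsub b D)), sigma.
split=> // [|i j].
  rewrite !unitmx_mul Au unitmx_inv Du andbT /= unitmxE det_diag unitfE.
  by apply/prodf_neq0 => i _; rewrite mxE.
rewrite -!mulmxA; set D1 := invmx _ *m D in E *.
rewrite -[in LHS](mulKVmx Au A) !mxE mulr_suml; apply: eq_bigr => l _.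
by rewrite E mul_diag_mx !mxE !mulrA.
Qed.

(** * Column matroids in terms of ranks *)

Section ColumnRank.
Variables (K : fieldType) (m n : nat) (W : 'M[K]_(m, n)).
Local Notation colW := (fun j => col j W).

(** Freeness of a family of column vectors lives in the theory of abstract vector
    spaces; this brings it to matrix ranks, where rank inequalities apply. *)
Lemma lin_indep_colsub k (g : 'I_k -> 'I_n) : injective g ->
  ([set g i | i in 'I_k] \in lin_indep colW) = (\rank (colsub g W) == k).
Proof.
move=> g_inj; rewrite inE -mxrank_tr -[_ == k]/(row_free _).
have /(perm_map colW)/perm_free -> :
    perm_eq (enum [set g i | i in 'I_k]) [seq g i | i <- enum 'I_k].
  apply: uniq_perm => [||j]; rewrite ?(map_inj_uniq g_inj) ?enum_uniq //.
  rewrite mem_enum; apply/imsetP/mapP => -[i _ ->]; exists i => //.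
  by rewrite mem_enum.
set s := [seq colW j | j <- _].
have sz : size s == k by rewrite 2!size_map size_enum_ord.
have nths (i : 'I_k) : s`_i = col (g i) W.
  rewrite (nth_map (g i)); last by rewrite size_map size_enum_ord.
  by rewrite (nth_map i) ?size_enum_ord // nth_ord_enum.
have combE (u : 'I_k -> K) : \sum_i u i *: s`_i = ((\row_i u i) *m (colsub g W)^T)^T.
  apply/matrixP => p q; rewrite !mxE summxE; apply: eq_bigr => l _.
  by rewrite nths !mxE.
apply/(@freeP _ _ _ (Tuple sz))/idP => [fr|fr u].
  apply: inj_row_free => v vW; apply/rowP => i; rewrite mxE.
  apply: (fr (v 0)); rewrite combE.
  by rewrite (_ : \row_j v 0 j = v) ?vW ?trmx0 //; apply/rowP => j; rewrite mxE.
rewrite combE => /(congr1 trmx); rewrite trmxK trmx0 => u0 i.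
have /rowP/(_ i) : \row_j u j = 0.
  by apply: (row_free_inj fr); rewrite /= u0 mul0mx.
by rewrite !mxE.
Qed.

Lemma enum_val_imset (I : {set 'I_n}) : [set enum_val i | i in 'I_#|I|] = I.
Proof.
apply/setP => x; apply/imsetP/idP => [[i _ ->]|xI]; first exact: enum_valP.
by exists (enum_rank_in xI x); rewrite ?enum_rankK_in.
Qed.

Lemma lin_indep_rank (I : {set 'I_n}) :
  (I \in lin_indep colW) = (\rank (colsub (@enum_val _ (mem I)) W) == #|I|).
Proof. by rewrite -lin_indep_colsub ?enum_val_imset //; apply: enum_val_inj. Qed.

Lemma rank_colsub k (g : 'I_k -> 'I_n) : (\rank (colsub g W) <= \rank W)%N.
Proof.
rewrite -mxrank_tr -[\rank W]mxrank_tr mxrankS //.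
by rewrite trmx_mxsub rowsub_sub.
Qed.

Lemma mrank_column_matroid : mrank (column_matroid W) = \rank W.
Proof.
apply/eqP; rewrite eqn_leq; apply/andP; split.
  apply/bigmax_leqP => I; rewrite lin_indep_rank => /eqP <-.
  exact: rank_colsub.
have rkT : \rank W^T = \rank W := mxrank_tr W.
apply: (bigop.bigmax_sup [set maxrankfun W^T i | i in 'I_(\rank W^T)]).
  rewrite /= lin_indep_colsub; last exact: maxrankfun_inj.
  by rewrite -mxrank_tr trmx_mxsub eq_maxrowsub.
by rewrite card_imset ?card_ord ?rkT //; apply: maxrankfun_inj.
Qed.

End ColumnRank.

Lemma eq_column_matroid (K : fieldType) (m p n : nat) (W : 'M[K]_(m, n))
  (W' : 'M[K]_(p, n)) : (W :=: W')%MS -> column_matroid W = column_matroid W'.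
Proof.
suff sub a c (U : 'M[K]_(a, n)) (U' : 'M[K]_(c, n)) : (U <= U')%MS ->
    forall I, I \in lin_indep (fun j => col j U) -> I \in lin_indep (fun j => col j U').
  move=> WW'; apply/matroid_inj/setP => I.
  by apply/idP/idP; apply: sub; rewrite WW'.
move=> /submxP[B ->] I; rewrite !lin_indep_rank => /eqP rI.
rewrite eqn_leq rank_leq_col -[X in (X <= _)%N]rI.
by rewrite -mulmx_colsub mxrankM_maxr.
Qed.

Lemma det_colsub_eq0 (K : fieldType) (r n : nat) (W : 'M[K]_(r, n))
    (g : 'I_r -> 'I_n) :
  (\det (colsub g W) != 0) =
  injectiveb g && ([set g i | i in 'I_r] \in lin_indep (fun j => col j W)).
Proof.
have [/injectiveP gi|] := boolP (injectiveb g).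
  by rewrite lin_indep_colsub // -unitfE -unitmxE -row_full_unit.
case/injectivePn => i [j ij gij]; rewrite -det_tr (determinant_alternate ij) ?eqxx //.
by move=> l; rewrite !mxE gij.
Qed.

(** Any row basis will do, listed in increasing order of its rows. *)
Lemma increasing_row_basis (K : fieldType) (m n : nat) (W : 'M[K]_(m, n)) :
  exists2 f : 'I_(\rank W) -> 'I_m,
    {homo f : i j / (i < j)%N} & column_matroid (rowsub f W) = column_matroid W.
Proof.
pose S := [set maxrankfun W i | i in 'I_(\rank W)].
have cS : #|S| = \rank W by rewrite card_imset ?card_ord //; apply: maxrankfun_inj.
pose f i := Order.enum_val (cast_ord (esym cS) i) : 'I_m.
have f_incr : {homo f : i j / (i < j)%N}.
  move=> i j ij; rewrite -[(f i < f j)%N]/(f i < f j)%O.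
  by rewrite (leW_mono (Order.le_enum_val (@le_total _ _) (A := _))).
exists f => //; apply/eq_column_matroid/eqmxP.
rewrite rowsub_sub /=.
have sub : (rowsub (maxrankfun W) W <= rowsub f W)%MS.
  apply/row_subP => i; rewrite row_rowsub.
  have iS : maxrankfun W i \in S by apply: imset_f.
  have [j ->] : exists j, maxrankfun W i = f j.
    exists (cast_ord cS (Order.enum_rank_in iS (maxrankfun W i))).
    by rewrite /f cast_ordK Order.enum_rankK_in.
  by rewrite -row_rowsub row_sub.
by apply: submx_trans sub; rewrite eq_maxrowsub.
Qed.

(** * Matrices equal up to row operations and column scaling *)

Section ProjectiveEquivalence.
Variables (K : fieldType) (r n : nat) (A D : 'M[K]_(r, n)).
Variables (T : 'M[K]_r) (s : 'rV[K]_n).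
Hypothesis AE : A = T *m D *m diag_mx s.

Lemma colsub_proj_equiv k (g : 'I_k -> 'I_n) :
  colsub g A = T *m colsub g D *m diag_mx (colsub g s).
Proof. by rewrite AE mulmx_colsub !mul_mx_diag; apply/matrixP => i j; rewrite !mxE. Qed.

Lemma det_proj_equiv (g : 'I_r -> 'I_n) :
  \det (colsub g A) = \det T * \det (colsub g D) * \prod_i s 0 (g i).
Proof.
rewrite colsub_proj_equiv !det_mulmx det_diag; congr (_ * _).
by apply: eq_bigr => i _; rewrite !mxE.
Qed.

Lemma column_matroid_proj_equiv : T \in unitmx -> (forall j, s 0 j != 0) ->
  column_matroid A = column_matroid D.
Proof.
move=> Tu s0; apply/matroid_inj/setP => I; rewrite !lin_indep_rank.
rewrite colsub_proj_equiv mxrankMfree; last first.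
  rewrite row_free_unit unitmxE det_diag unitfE.
  by apply/prodf_neq0 => i _; rewrite mxE.
by rewrite eqmxMfull // row_full_unit.
Qed.

End ProjectiveEquivalence.

(** * Incidence matrices under relabelling and reversal *)

Section Incidence.
Variables (K : fieldType) (n : nat) (G : multigraph 'I_n).
Variable o : 'I_n -> 'I_(nverts G) * 'I_(nverts G).
Hypothesis oP : orientation o.

Lemma column_matroid_incidence : column_matroid (incidence_mx K o) = cycle_matroid G.
Proof.
apply/matroid_inj/setP => I; rewrite /= (forests_lin_indep K oP) !inE; congr (free _).
by apply: eq_map => j; apply/colP => v; rewrite !mxE.
Qed.

Definition relabel (p : {perm 'I_(nverts G)}) : multigraph 'I_n.
Proof.
exists (nverts G) (fun e => p @: ends G e) => e.
by rewrite card_imset; [apply: ends_card|apply: perm_inj].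
Defined.

Definition relabel_orientation (p : {perm 'I_(nverts G)}) (e : 'I_n) :
  'I_(nverts (relabel p)) * 'I_(nverts (relabel p)) := (p (o e).1, p (o e).2).

Lemma relabel_orientationP p : orientation (relabel_orientation p).
Proof. by move=> e; rewrite /= oP imsetU !imset_set1. Qed.

Lemma incidence_relabel p v e :
  incidence_mx K (relabel_orientation p) (p v) e = incidence_mx K o v e.
Proof. by rewrite !mxE !(inj_eq perm_inj). Qed.

Definition reverse (S : {pred 'I_n}) (e : 'I_n) :=
  if e \in S then ((o e).2, (o e).1) else o e.

Lemma reverse_orientation S : orientation (reverse S).
Proof. by move=> e; rewrite /reverse oP; case: ifP => //= _; rewrite setUC. Qed.

Lemma incidence_reverse S v e : incidence_mx K (reverse S) v e =
  (if e \in S then -1 else 1) * incidence_mx K o v e.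
Proof. by rewrite !mxE /reverse; case: ifP => _; rewrite ?mul1r // mulN1r opprB. Qed.

End Incidence.

(** The incidence matrices differ by a permutation of the rows, which does not
    affect the dependences between columns. *)
Lemma cycle_matroid_relabel n (G : multigraph 'I_n) (p : {perm 'I_(nverts G)}) :
  cycle_matroid (relabel p) = cycle_matroid G.
Proof.
have [o oP] := orientation_ex G.
rewrite -(column_matroid_incidence rat oP).
rewrite -(column_matroid_incidence rat (relabel_orientationP oP p)).
apply: eq_column_matroid.
rewrite -(_ : row_perm p (incidence_mx rat (relabel_orientation o p)) =
             incidence_mx rat o); last first.
  by apply/matrixP => v e; rewrite mxE incidence_relabel.
rewrite row_permE; apply: eqmx_sym; apply: eqmxMfull.
by rewrite row_full_unit unitmx_perm.
Qed.

Lemma graphic_on_ground_set n (P : matroid 'I_n) :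
  graphic P -> exists G : multigraph 'I_n, cycle_matroid G = P.
Proof.
case=> F [G [f /bij_inj f_inj PE]].
pose H := @Multigraph _ (nverts G) (fun e => ends G (f e)) (fun e => ends_card G (f e)).
have [o oP] := orientation_ex G.
have oH : orientation (G := H) (fun e => o (f e)) by move=> e; rewrite /= oP.
exists H; apply/matroid_inj/setP => I; rewrite PE /=.
rewrite (forests_lin_indep rat oP) (forests_lin_indep rat oH) !inE.
rewrite (map_comp (incidence_col rat o) f); apply/perm_free/perm_map.
apply: uniq_perm; rewrite ?enum_uniq ?(map_inj_uniq f_inj) ?enum_uniq // => e.
rewrite mem_enum; apply/mapP/imsetP => -[i iI ->]; exists i => //.
  by rewrite mem_enum in iI.
by rewrite mem_enum.
Qed.

(** * Nonnegative maximal minors *)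

Lemma homo_ord_id r (f : 'I_r -> 'I_r) : {homo f : i j / (i < j)%N} -> f =1 id.
Proof.
move=> fi.
have lo d (i : 'I_r) : i = d :> nat -> (i <= f i)%N.
  elim: d i => [|d IHd] i id; first by rewrite id.
  have dr : (d < r)%N by rewrite ltnW // -id.
  rewrite id (leq_ltn_trans (IHd (Ordinal dr) erefl)) // fi //= id.
  exact: ltnSn.
have hi d (i : 'I_r) : (i + d.+1 = r)%N -> (f i + d < r)%N.
  elim: d i => [|d IHd] i id; first by rewrite addn0.
  have dr : (i.+1 < r)%N by lia.
  have /= := IHd (Ordinal dr); have /= := fi i (Ordinal dr) (ltnSn _).
  lia.
move=> i; apply/val_inj/eqP; rewrite eqn_leq (lo i) // andbT /=.
have := hi (r - i.+1)%N i; have := ltn_ord i; lia.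
Qed.

Lemma nonneg_maximal_minors_colsub (R : realType) r n (A : 'M[R]_(r, n)) :
  (r <= n)%N -> nonneg_maximal_minors A <->
  (forall g : 'I_r -> 'I_n, {homo g : i j / (i < j)%N} -> 0 <= \det (colsub g A)).
Proof.
move=> rn; rewrite /nonneg_maximal_minors (minn_idPl rn); split=> [nn g gi|nn f g fi gi].
  exact: nn.
by rewrite (mxsub_eq_colsub g (homo_ord_id fi)); apply: nn.
Qed.

(** Exchanging two kept rows, by renaming their vertices, changes the sign of
    det T.  With a single row there is nothing to exchange, but T and s can both
    be negated.  With no row, det T = 1. *)
Lemma positive_equivalence (R : realType) r n (G : multigraph 'I_n)
    (o : 'I_n -> 'I_(nverts G) * 'I_(nverts G)) (f : 'I_r -> 'I_(nverts G))
    (A : 'M[R]_(r, n)) (T : 'M[R]_r) (s : 'rV[R]_n) :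
  orientation o -> {homo f : i j / (i < j)%N} -> T \in unitmx ->
  (forall j, s 0 j != 0) -> A = T *m rowsub f (incidence_mx R o) *m diag_mx s ->
  exists (G' : multigraph 'I_n) (o' : 'I_n -> 'I_(nverts G') * 'I_(nverts G'))
    (f' : 'I_r -> 'I_(nverts G')) (T' : 'M[R]_r) (s' : 'rV[R]_n),
  [/\ cycle_matroid G' = cycle_matroid G, orientation o',
      {homo f' : i j / (i < j)%N} &
      [/\ 0 < \det T', forall j, s' 0 j != 0 &
          A = T' *m rowsub f' (incidence_mx R o') *m diag_mx s']].
Proof.
move=> oP f_incr Tu s0 AE.
have f_inj : injective f.
  move=> i j fij; apply/val_inj.
  by case: (ltngtP i j) => // /f_incr; rewrite fij ltnn.
case: (ltgtP (\det T) 0) => [Tneg|Tpos|T0]; last first.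
- by move: Tu; rewrite unitmxE T0 unitr0.
- by exists G, o, f, T, s.
case: r => [|[|r]] in f A T f_incr Tu AE f_inj Tneg *.
- by move: Tneg; rewrite det_mx00 ltr10.
- exists G, o, f, (- T), (- s); split=> //; split.
  + by rewrite -scaleN1r detZ expr1 mulN1r oppr_gt0.
  + by move=> j; rewrite mxE oppr_eq0.
  + by rewrite raddfN mulNmx mulmxN mulNmx opprK.
pose i0 : 'I_r.+2 := ord0; pose i1 : 'I_r.+2 := lift ord0 ord0.
pose p := tperm (f i0) (f i1).
exists (relabel p), (relabel_orientation o p), f, (T *m tperm_mx i0 i1), s.
split=> //; [exact: cycle_matroid_relabel|exact: (relabel_orientationP oP)|split=> //].
  by rewrite det_mulmx det_perm odd_tperm mulrN1 oppr_gt0.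
rewrite AE; congr (_ *m _); rewrite -mulmxA -xrowE; congr (_ *m _).
apply/matrixP => i e; rewrite !mxE.
by rewrite (inj_tperm _ _ _ f_inj) -/p !(inj_eq perm_inj).
Qed.

(** * The theorem *)

Theorem theorem5p2 (R : realType) (n r : nat) (P : matroid 'I_n)
    (rankP : mrank P = r) (posP : positroid R P) (graphicP : graphic P) :
  exists (G : multigraph 'I_n) (A : 'M[R]_(r, n)),
    [/\ cycle_matroid G = P, column_matroid A = P, nonneg_maximal_minors A &
        exists2 D : 'M[R]_(nverts G, n),
          signed_incidence D & deletes_rows D A].
Proof.
case: posP; rewrite rankP => A [rkA AP Ann].
have rn : (r <= n)%N by rewrite -rkA rank_leq_col.
have [G GP] := graphic_on_ground_set graphicP.
have [o oP] := orientation_ex G.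
have row_basis (K : fieldType) : exists2 f : 'I_r -> 'I_(nverts G),
    {homo f : i j / (i < j)%N} & column_matroid (rowsub f (incidence_mx K o)) = P.
  have WP : column_matroid (incidence_mx K o) = P by rewrite column_matroid_incidence.
  have rk : \rank (incidence_mx K o) = r by rewrite -mrank_column_matroid WP.
  by have := increasing_row_basis (incidence_mx K o); rewrite rk WP.
have [f f_incr DP] := row_basis R.
have [h _ XP] := row_basis 'F_2.
set D := rowsub f _ in DP; set X := rowsub h _ in XP.
have detP (K : fieldType) (M : 'M[K]_(r, n)) g : column_matroid M = P ->
    (\det (colsub g M) == 0) = ~~ (injectiveb g && ([set g i | i in 'I_r] \in indep P)).
  by move=> <-; rewrite -det_colsub_eq0 negbK.
have [b bX] : exists b : 'I_r -> 'I_n, \det (colsub b X) != 0.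
  have fX : row_full X^T by rewrite /row_full mxrank_tr -mrank_column_matroid XP rankP.
  exists (fullrankfun fX); rewrite -unitfE -unitmxE -unitmx_tr trmx_mxsub.
  exact: fullrowsub_unit.
have [||T [s [Tu s0 AE]]] := binary_matrix_unique bX (A := A) (D := D).
- by move=> g; rewrite !detP.
- by move=> g; rewrite !detP.
have {}AE : A = T *m D *m diag_mx (\row_j s j).
  by apply/matrixP => i j; rewrite AE mul_mx_diag !mxE.
have s'0 j : (\row_j s j) 0 j != 0 by rewrite mxE.
have [G' [o' [f' [T' [t [G'G o'P f'_incr [T'pos t0 AE']]]]]]] :=
  positive_equivalence oP f_incr Tu s'0 AE.
(* This turns the scaling factors into their absolute values. *)
pose o'' := reverse o' [pred e | t 0 e < 0].
pose D'' := incidence_mx R o''.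
have o''P : orientation o'' by apply: reverse_orientation.
have AE'' : A = T' *m rowsub f' D'' *m diag_mx (\row_j `|t 0 j|).
  rewrite AE' -!mulmxA; congr (_ *m _); apply/matrixP => i j.
  rewrite !mul_mx_diag [LHS]mxE [RHS]mxE [rowsub f' D'' i j]mxE incidence_reverse.
  rewrite [rowsub f' _ i j]mxE [(\row__ _) 0 j]mxE inE.
  case: (ltP (t 0 j) 0) => tj; last by rewrite mul1r ger0_norm.
  by rewrite ltr0_norm // mulN1r mulrNN.
exists G', (rowsub f' D''); split; first by rewrite G'G.
- rewrite -AP; apply/esym; apply: column_matroid_proj_equiv AE'' _ _.
    by rewrite unitmxE unitfE gt_eqF.
  by move=> j; rewrite mxE normr_eq0.
- apply/nonneg_maximal_minors_colsub => // g gi.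
  have := (nonneg_maximal_minors_colsub A rn).1 Ann g gi.
  rewrite (det_proj_equiv AE'') -mulrA pmulr_rge0 // pmulr_lge0 //.
  by apply: prodr_gt0 => i _; rewrite mxE normr_gt0.
- exists D''; first by exists o''.
  by exists f'.
Qed.
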